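(* Let $\alpha,\beta$ be two curves immersed in the Euclidean space $\mathbb{R}^{3}$. \begin{enumerate} \item Let $N$ be a unit normal vector field along a curve $\alpha$. The ruled surface $f(s,\lambda)=\alpha(s)+\lambda N(s)$ defined by $N$ along $\alpha$ is developable if and only if $N$ is an RM vector field along $\alpha$. \item If $\alpha$ is the evolute of $\beta$ (and $\beta$ the involute of $\alpha$), then $$N(s)=\frac{\beta(s)-\alpha(s)}{\|\beta(s)-\alpha(s)\|}$$ defines an RM vector field along $\beta$. \item The ruled surface defined by an RM vector field along a curve $\alpha$ is a tangential surface. \end{enumerate}
   Context: Curves, vector fields and surfaces are smooth. A normal vector field $N$ along an immersed curve $\alpha$ in $\mathbb{R}^3$ (that is, $N(s)\perp\alpha'(s)$ for all $s$) is called a rotation minimizing (RM) vector field if it is parallel with respect to the normal connection of $\alpha$; equivalently, $N'(s)$ is proportional to $\alpha'(s)$ (i.e. $N'(s)=a(s)\alpha'(s)$ for a function $a$). The ruled surface defined by a vector field $N$ along $\alpha$ is the surface $f(s,\lambda)=\alpha(s)+\lambda N(s)$, $\lambda\in\mathbb{R}$. A ruled surface is developable if its tangent plane at a (regular) point coincides with the tangent plane at any other (regular) point of the same ruling line; equivalently, the triple product $[\alpha',N,N']$ vanishes identically. The tangential surface of a curve is the ruled surface formed by the tangent lines of that curve; a tangential surface is a surface that is the tangential surface of some curve. The curve $\alpha$ is an evolute of $\beta$, and $\beta$ is an involute of $\alpha$, if $\beta$ is contained in the tangential surface of $\alpha$ and meets the tangent lines of $\alpha$ orthogonally; the two curves are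 parametrized by a common parameter $s$ so that $\beta(s)$ lies on the tangent line of $\alpha$ at $\alpha(s)$. (If $\alpha$ has unit speed, then $\beta(s)=\alpha(s)+(c-s)\alpha'(s)$ with $c$ a constant.)
   Formalization: Item 3 fails for cylinders and cones (e.g. a circle with constant N=(0,0,1)), so it is stated for RM fields with N'=aα' where both a and a' vanish nowhere on the interval; this is exactly when the rulings are the tangent lines of an immersed curve. *)

(* Defs.v *)
From mathcomp Require Import all_boot all_order all_algebra.
From mathcomp Require Import all_classical all_reals all_analysis.
Set Implicit Arguments.
Unset Strict Implicit.
Unset Printing Implicit Defensive.
Import Order.TTheory GRing.Theory Num.Theory numFieldNormedType.Exports.
Local Open Scope ring_scope.
Local Open Scope classical_set_scope.

Section RotationMinimizing.
Variable R : realType.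

(* The library norm on 'rV[R]_3 is the sup norm, hence the Euclidean structure
   is introduced here; the two norms induce the same derivatives. *)
Definition dot (u v : 'rV[R]_3) : R := (u *m v^T) 0 0.
Definition enorm (u : 'rV[R]_3) : R := Num.sqrt (dot u u).

(* Parameter domains are open intervals of R, possibly unbounded. *)
Definition open_interval (I : set R) : Prop := open I /\ is_interval I.

(* The map f is total; its values outside the open set I are irrelevant. *)
Definition smooth_on (I : set R) (f : R -> 'rV[R]_3) : Prop :=
  forall (n : nat) (s : R), I s -> derivable (derive1n n f) s 1.

Definition immersed (I : set R) (c : R -> 'rV[R]_3) : Prop :=
  smooth_on I c /\ forall s, I s -> derive1 c s != 0.

Definition normal_field (I : set R) (c N : R -> 'rV[R]_3) : Prop :=
  smooth_on I N /\ forall s, I s -> dot (N s) (derive1 c s) = 0.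

Definition normal_part (c : R -> 'rV[R]_3) (s : R) (v : 'rV[R]_3) : 'rV[R]_3 :=
  v - (dot v (derive1 c s) / dot (derive1 c s) (derive1 c s)) *: derive1 c s.

(* Normal connection of c: normal component of the derivative in R^3. *)
Definition normal_derivative (c N : R -> 'rV[R]_3) (s : R) : 'rV[R]_3 :=
  normal_part c s (derive1 N s).

(* Parallel for the normal connection, i.e. N' is proportional to c'. *)
Definition rm_field (I : set R) (c N : R -> 'rV[R]_3) : Prop :=
  normal_field I c N /\ forall s, I s -> normal_derivative c N s = 0.

Definition ruled_surface (c N : R -> 'rV[R]_3) (s lambda : R) : 'rV[R]_3 :=
  c s + lambda *: N s.

(* The two rows are the partial derivatives of f at (s, lambda). *)
Definition tangent_frame (f : R -> R -> 'rV[R]_3) (s lambda : R) : 'M[R]_(2, 3) :=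
  col_mx (derive1 (f ^~ lambda) s) (derive1 (f s) lambda).

Definition regular_point (f : R -> R -> 'rV[R]_3) (s lambda : R) : Prop :=
  row_free (tangent_frame f s lambda).

(* The affine tangent plane, as a subset of R^3. *)
Definition tangent_plane (f : R -> R -> 'rV[R]_3) (s lambda : R) : set 'rV[R]_3 :=
  [set p | (p - f s lambda <= tangent_frame f s lambda)%MS].

Definition developable (I : set R) (f : R -> R -> 'rV[R]_3) : Prop :=
  forall s lambda mu, I s ->
    regular_point f s lambda -> regular_point f s mu ->
    tangent_plane f s lambda = tangent_plane f s mu.

Definition tangential_surface (c : R -> 'rV[R]_3) : R -> R -> 'rV[R]_3 :=
  ruled_surface c (derive1 c).

(* Equality of ruled surfaces line by line: the ruling of f at s is the tangent
   line of g at s. In particular the two surfaces have the same image. *)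
Definition is_tangential_surface (I : set R) (f : R -> R -> 'rV[R]_3) : Prop :=
  exists2 g : R -> 'rV[R]_3, immersed I g &
    forall s, I s -> range (f s) = range (tangential_surface g s).

(* a is an evolute of b, i.e. b is an involute of a. *)
Definition evolute (I : set R) (a b : R -> 'rV[R]_3) : Prop :=
  (forall s, I s -> range (tangential_surface a s) (b s)) /\
  (forall s, I s -> dot (derive1 b s) (derive1 a s) = 0).

End RotationMinimizing.

(* Main.v *)
(** (1) The normal part [w] of [N'] is orthogonal to [c'] and to [N]; if the
    tangent planes at [lambda = 0] and [lambda = 1] coincide, then [w] also lies
    in their span, so [w = 0].  (2) Differentiating [beta - alpha = r N] gives
    [beta' = (alpha' + r' N) + r N'], where the first summand is a multiple of
    [N] orthogonal to [N], so [N' = beta' / r].  (3) The curve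
    [g = alpha - N / a] satisfies [g' = (a' / a ^+ 2) N], so its tangent lines
    are the rulings; [N] has no zero because [|N|] is constant and [N' <> 0]. *)

Require Import Defs.
From mathcomp Require Import all_boot all_order all_algebra.
From mathcomp Require Import all_classical all_reals all_analysis.
From mathcomp Require Import ring.
Import Order.TTheory GRing.Theory Num.Theory numFieldNormedType.Exports.
Local Open Scope ring_scope.
Local Open Scope classical_set_scope.
Set Implicit Arguments.
Unset Strict Implicit.
Unset Printing Implicit Defensive.

(** * Euclidean inner product on row vectors *)

Section Dot.
Context {R : realType}.
Implicit Types (u v w : 'rV[R]_3) (k : R).

Lemma dotE u v : dot u v = \sum_i u 0 i * v 0 i.
Proof. by rewrite /dot mxE; apply: eq_bigr => i _; rewrite mxE. Qed.

Lemma dotC u v : dot u v = dot v u.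
Proof. by rewrite !dotE; apply: eq_bigr => i _; rewrite mulrC. Qed.

Lemma dotDl u v w : dot (u + v) w = dot u w + dot v w.
Proof. by rewrite /dot mulmxDl mxE. Qed.

Lemma dotZl k u v : dot (k *: u) v = k * dot u v.
Proof. by rewrite /dot -scalemxAl mxE. Qed.

Lemma dotDr u v w : dot w (u + v) = dot w u + dot w v.
Proof. by rewrite dotC dotDl !(dotC _ w). Qed.

Lemma dotZr k u v : dot u (k *: v) = k * dot u v.
Proof. by rewrite dotC dotZl dotC. Qed.

Lemma dotNl u v : dot (- u) v = - dot u v.
Proof. by rewrite -scaleN1r dotZl mulN1r. Qed.

Lemma dot0l u : dot 0 u = 0.
Proof. by rewrite -(scale0r 0) dotZl mul0r. Qed.

Lemma dot_ge0 u : 0 <= dot u u.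
Proof. by rewrite dotE; apply: sumr_ge0 => i _; rewrite -expr2 sqr_ge0. Qed.

Lemma dot_eq0 u : (dot u u == 0) = (u == 0).
Proof.
apply/eqP/eqP => [|->]; last exact: dot0l.
rewrite dotE => /eqP.
rewrite psumr_eq0 => [/allP u0|i _]; last by rewrite -expr2 sqr_ge0.
apply/rowP => i; rewrite mxE.
by have := u0 i (mem_index_enum _); rewrite -expr2 sqrf_eq0 => /eqP.
Qed.

Lemma dot_gt0 u : (0 < dot u u) = (u != 0).
Proof. by rewrite lt_def dot_ge0 dot_eq0 andbT. Qed.

Lemma sqr_enorm u : enorm u ^+ 2 = dot u u.
Proof. by rewrite sqr_sqrtr ?dot_ge0. Qed.

Lemma enorm_gt0 u : (0 < enorm u) = (u != 0).
Proof. by rewrite sqrtr_gt0 dot_gt0. Qed.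

End Dot.

(** * Differentiation rules for scalar and vector functions of one real variable *)

Section Derivatives.
Context {R : realType}.
Implicit Types (f g : R -> R) (u v : R -> 'rV[R]_3) (s : R).

(** Reduces the vector rules below to scalar ones, one coordinate at a time. *)
Lemma is_derive_rowP u (l : 'rV[R]_3) s :
  is_derive s 1 u l <-> forall i, is_derive s 1 (fun t => u t 0 i) (l 0 i).
Proof.
split=> [[du <-] i|du].
  rewrite derive_mx// mxE; apply: DeriveDef => //.
  by move/derivable_mxP: du; exact.
have der_u : derivable u s 1.
  by apply/derivable_mxP => j i; rewrite ord1; case: (du i).
apply: DeriveDef => //; rewrite derive_mx//; apply/rowP => i; rewrite mxE.
by case: (du i).
Qed.

Lemma is_derive1E (V : normedModType R) (u : R -> V) s (l : V) :
  is_derive s 1 u l -> derive1 u s = l.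
Proof. by case=> _ <-; rewrite derive1E. Qed.

Lemma derivable_is_derive1 (V : normedModType R) (u : R -> V) s :
  derivable u s 1 -> is_derive s 1 u (derive1 u s).
Proof. by move=> du; rewrite derive1E; exact: derivableP. Qed.

Lemma is_derive_mul f g (df dg : R) s :
  is_derive s 1 f df -> is_derive s 1 g dg ->
  is_derive s 1 (fun t => f t * g t) (df * g s + f s * dg).
Proof.
move=> hf hg; have h := is_deriveM hf hg; apply: (is_derive_eq h).
by rewrite /GRing.scale/=; ring.
Qed.

Lemma is_derive_inv f (df : R) s : f s != 0 -> is_derive s 1 f df ->
  is_derive s 1 (fun t => (f t)^-1) (- df * ((f s)^-1 * (f s)^-1)).
Proof.
move=> f0 hf; have [dfs <-] := hf.
apply: DeriveDef; first exact: derivableV.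
by rewrite deriveV// /GRing.scale/=; field.
Qed.

Lemma is_derive_sqrt f (df : R) s : 0 < f s -> is_derive s 1 f df ->
  is_derive s 1 (fun t => Num.sqrt (f t)) (df * (2 * Num.sqrt (f s))^-1).
Proof.
move=> f0 hf.
have h := is_derive1_comp (is_derive1_sqrt f0) hf.
by apply: (is_derive_eq h); rewrite mulrC.
Qed.

Lemma is_derive_scale f u (df : R) (du : 'rV[R]_3) s :
  is_derive s 1 f df -> is_derive s 1 u du ->
  is_derive s 1 (fun t => f t *: u t) (df *: u s + f s *: du).
Proof.
move=> hf /is_derive_rowP hu; apply/is_derive_rowP => i.
under eq_fun do rewrite mxE.
by rewrite !mxE; exact: is_derive_mul.
Qed.

Lemma is_derive_dot u v (du dv : 'rV[R]_3) s :
  is_derive s 1 u du -> is_derive s 1 v dv ->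
  is_derive s 1 (fun t => dot (u t) (v t)) (dot du (v s) + dot (u s) dv).
Proof.
move=> /is_derive_rowP hu /is_derive_rowP hv.
have hm i := is_derive_mul (hu i) (hv i).
(* The three coordinates are written out so that the binary sum rule applies. *)
have h := is_deriveD (hm ord0) (is_deriveD (hm (lift ord0 ord0))
  (hm (lift ord0 (lift ord0 ord0)))).
under eq_fun do rewrite dotE !big_ord_recl big_ord0 addr0.
apply: (is_derive_eq h).
by rewrite !dotE !big_ord_recl !big_ord0; ring.
Qed.

End Derivatives.

(** * Differentiability of finite order on an open set, and its closure properties *)

Section Smooth.
Context {R : realType} {I : set R} (openI : open I).

(** Peels one derivative off [f] at each step and allows any codomain, so that closure rules follow
    by induction on the order, for scalars and vectors alike. *)
Fixpoint ndiff {V : normedModType R} (k : nat) (f : R -> V) : Prop :=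
  if k is k'.+1 then
    (forall s, I s -> derivable f s 1) /\ ndiff k' (derive1 f)
  else True.

Lemma smooth_ndiffP (f : R -> 'rV[R]_3) :
  smooth_on I f <-> forall k, ndiff k f.
Proof.
split=> [+ k|].
  elim: k f => [//|k IH] f fs; split; first exact: (fs 0%N).
  by apply: IH => n s Is; rewrite -derive1Sn; exact: fs.
(* Derivability of the [n]-th derivative is contained in order [n.+1] of [ndiff]; hence order 1 in
   the base case. *)
move=> + n; elim: n f => [f fs s Is|n IH f fs s Is]; first exact: (fs 1%N).1.
by rewrite derive1Sn; apply: IH => // k; exact: (fs k.+1).2.
Qed.

Lemma open_near_eq (V : normedModType R) (f g : R -> V) s :
  (forall t, I t -> f t = g t) -> I s -> \near s, f s = g s.
Proof.
move=> fg Is; have : nbhs s I by exact: open_nbhs_nbhs.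
by apply: filterS => t /fg.
Qed.

(** Derivatives see only the values near a point, and [I] is open, so values outside [I] do not
    matter. *)
Lemma ndiff_ext (V : normedModType R) k (f g : R -> V) :
  (forall s, I s -> f s = g s) -> ndiff k f -> ndiff k g.
Proof.
elim: k f g => [//|k IH] f g fg [df nf]; split=> [s Is|].
  by apply: near_eq_derivable (df s Is); exact: open_near_eq.
apply: IH nf => s Is; rewrite !derive1E; apply: near_eq_derive.
exact: open_near_eq.
Qed.

(** Inductive step of the closure rules: a formula for the derivative that is valid on [I] only may
    stand in for [derive1 f]. *)
Lemma ndiff_is_derive (V : normedModType R) k (f df : R -> V) :
  (forall s, I s -> is_derive s 1 f (df s)) -> ndiff k df -> ndiff k.+1 f.
Proof.
move=> fdf ndf; split=> [s /fdf[]//|].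
by apply: ndiff_ext ndf => s /fdf /is_derive1E.
Qed.

Lemma ndiffS (V : normedModType R) k (f : R -> V) :
  ndiff k.+1 f ->
  (forall s, I s -> is_derive s 1 f (derive1 f s)) /\ ndiff k (derive1 f).
Proof. by case=> df nf; split=> // s /df/derivable_is_derive1. Qed.

(** Derivatives of products, inverses and roots contain undifferentiated factors, for which one
    order has to be dropped. *)
Lemma ndiffW (V : normedModType R) k (f : R -> V) : ndiff k.+1 f -> ndiff k f.
Proof. by elim: k f => [//|k IH] f [df /IH]. Qed.

Lemma ndiff_cst (V : normedModType R) k (a : V) : ndiff k (fun=> a).
Proof.
elim: k a => [//|k IH] a; apply: (@ndiff_is_derive _ _ _ (fun=> 0)).
by [].
Qed.

Lemma ndiffD (V : normedModType R) k (f g : R -> V) :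
  ndiff k f -> ndiff k g -> ndiff k (fun s => f s + g s).
Proof.
elim: k f g => [//|k IH] f g /ndiffS[df nf] /ndiffS[dg ng].
apply: ndiff_is_derive (IH _ _ nf ng) => s Is.
exact: is_deriveD (df s Is) (dg s Is).
Qed.

Lemma ndiffN (V : normedModType R) k (f : R -> V) :
  ndiff k f -> ndiff k (fun s => - f s).
Proof.
elim: k f => [//|k IH] f /ndiffS[df nf].
by apply: ndiff_is_derive (IH _ nf) => s Is; exact: is_deriveN (df s Is).
Qed.

Lemma ndiffB (V : normedModType R) k (f g : R -> V) :
  ndiff k f -> ndiff k g -> ndiff k (fun s => f s - g s).
Proof. by move=> nf ng; exact: ndiffD nf (ndiffN ng). Qed.

Lemma ndiffM k (f g : R -> R) :
  ndiff k f -> ndiff k g -> ndiff k (fun s => f s * g s).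
Proof.
elim: k f g => [//|k IH] f g nf ng.
have [df nf'] := ndiffS nf; have [dg ng'] := ndiffS ng.
apply: ndiff_is_derive; last first.
  exact: ndiffD (IH _ _ nf' (ndiffW ng)) (IH _ _ (ndiffW nf) ng').
by move=> s Is; exact: is_derive_mul (df s Is) (dg s Is).
Qed.

Lemma ndiffV k (f : R -> R) : (forall s, I s -> f s != 0) ->
  ndiff k f -> ndiff k (fun s => (f s)^-1).
Proof.
move=> f0; elim: k => [//|k IH] nf.
have [df nf'] := ndiffS nf; have nV := IH (ndiffW nf).
(* The derivative of [1 / f] contains [1 / f] again, but only at order [k], where [nV] covers it. *)
apply: ndiff_is_derive; last first.
  exact: (ndiffM (ndiffN nf') (ndiffM nV nV)).
by move=> s Is; exact: is_derive_inv (f0 s Is) (df s Is).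
Qed.

Lemma ndiff_sqrt k (f : R -> R) : (forall s, I s -> 0 < f s) ->
  ndiff k f -> ndiff k (fun s => Num.sqrt (f s)).
Proof.
move=> f0; elim: k => [//|k IH] nf.
have [df nf'] := ndiffS nf; have nS := IH (ndiffW nf).
apply: ndiff_is_derive => [s Is|].
  exact: is_derive_sqrt (f0 s Is) (df s Is).
(* Likewise [f' / (2 sqrt f)] contains the root at order [k] only, and positivity keeps the
   denominator away from zero. *)
apply: (ndiffM nf' (ndiffV _ (ndiffM (ndiff_cst k (2 : R)) nS))) => s /f0 fs.
by rewrite mulf_neq0// sqrtr_eq0 -ltNge.
Qed.

Lemma ndiff_rowP k (u : R -> 'rV[R]_3) :
  ndiff k u <-> forall i, ndiff k (fun s => u s 0 i).
Proof.
elim: k u => [//|k IH] u; split=> [/ndiffS[du /IH nu] i|nu].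
  by apply: ndiff_is_derive (nu i) => s /du/is_derive_rowP/(_ i).
pose l s : 'rV[R]_3 := \row_i derive1 (fun t => u t 0 i) s.
apply: (@ndiff_is_derive _ _ _ l) => [s Is|].
  apply/is_derive_rowP => i; rewrite mxE.
  by have [+ _] := ndiffS (nu i); exact.
apply/IH => i; apply: ndiff_ext (nu i).2 => s _.
by rewrite mxE.
Qed.

Lemma ndiff_scale k (f : R -> R) (u : R -> 'rV[R]_3) :
  ndiff k f -> ndiff k u -> ndiff k (fun s => f s *: u s).
Proof.
move=> nf /ndiff_rowP nu; apply/ndiff_rowP => i.
by under eq_fun do rewrite mxE; exact: ndiffM.
Qed.

Lemma ndiff_dot k (u v : R -> 'rV[R]_3) :
  ndiff k u -> ndiff k v -> ndiff k (fun s => dot (u s) (v s)).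
Proof.
move=> /ndiff_rowP nu /ndiff_rowP nv.
have nm i := ndiffM (nu i) (nv i).
apply: (ndiff_ext _ (ndiffD (nm ord0) (ndiffD (nm (lift ord0 ord0))
  (nm (lift ord0 (lift ord0 ord0)))))) => s _.
by rewrite dotE !big_ord_recl big_ord0 addr0.
Qed.

End Smooth.

(** Mean value theorem on the segment from [s] to [t], which lies in [I] because [I] is an
    interval. *)
Lemma derive0_cst (R : realType) (I : set R) (f : R -> R) :
  is_interval I -> (forall s, I s -> is_derive s 1 f 0) ->
  forall s t, I s -> I t -> f s = f t.
Proof.
move=> itvI df s t.
wlog st : s t / s <= t => [wl Is It|Is It].
  by case/orP: (le_total s t) => ?; [|apply/esym]; exact: wl.
have Ix x : x \in `[s, t]%R -> I x.
  by rewrite in_itv/= => sxt; exact: itvI sxt.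
have [x xst| |x _] := @MVT_segment _ f (fun=> 0) s t st.
- by apply: df; apply: Ix; exact: subset_itv_oo_cc.
- apply/continuous_in_subspaceT => x /[1!inE] xst.
  apply/differentiable_continuous/derivable1_diffP.
  by have [] := df x (Ix x xst).
- by rewrite mul0r => /eqP; rewrite subr_eq0 => /eqP.
Qed.

(** * Developable ruled surfaces, evolutes and tangential surfaces *)

Section Surfaces.
Context {R : realType} {I : set R} (openI : open I).
Implicit Types (c N : R -> 'rV[R]_3) (u v p : 'rV[R]_3) (s : R).

Lemma smooth_on_is_derive c s :
  smooth_on I c -> I s -> is_derive s 1 c (derive1 c s).
Proof. by move=> cs Is; apply/derivable_is_derive1/(cs 0%N). Qed.

(** Differentiating [dot N N = 1] gives twice the product in question; the equation holds on [I]
    only, so it is used as an equality near [s]. *)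
Lemma unit_field_derive_orthogonal N dN s :
  (forall t, I t -> enorm (N t) = 1) -> I s -> is_derive s 1 N dN ->
  dot (N s) dN = 0.
Proof.
move=> N1 Is hN; have := is_derive1E (is_derive_dot hN hN).
have /near_eq_derive : \near s, dot (N s) (N s) = cst 1 s.
  apply: open_near_eq Is => // t /N1 Nt1.
  by rewrite -sqr_enorm Nt1 expr1n.
rewrite derive1E => ->; rewrite derive_cst dotC => /esym/eqP.
by rewrite -mulr2n mulrn_eq0/= => /eqP; rewrite dotC.
Qed.

Lemma normal_derivative_eq0P c N s : derive1 c s != 0 ->
  normal_derivative c N s = 0 <-> exists k, derive1 N s = k *: derive1 c s.
Proof.
rewrite -dot_eq0 => c0; split=> [/eqP|[k Nk]].
  by rewrite subr_eq0 => /eqP ?; eexists; eassumption.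
by rewrite /normal_derivative /normal_part Nk dotZl mulfK// subrr.
Qed.

Lemma tangent_frame_ruled c N s lambda :
  smooth_on I c -> smooth_on I N -> I s ->
  tangent_frame (ruled_surface c N) s lambda =
  col_mx (derive1 c s + lambda *: derive1 N s) (N s).
Proof.
move=> cs Ns Is.
have hc := smooth_on_is_derive cs Is; have hN := smooth_on_is_derive Ns Is.
have hs := is_derive1E (is_deriveD hc (is_deriveZ lambda hN)).
have hl := is_derive1E (is_deriveD (is_derive_cst (c s) lambda 1)
  (is_derive_scale (is_derive_id lambda 1) (is_derive_cst (N s) lambda 1))).
rewrite /tangent_frame [X in col_mx X _]hs [X in col_mx _ X]hl.
by rewrite scaler0 scale1r add0r addr0.
Qed.

Lemma sub_col_mxP u v p :
  (p <= col_mx u v)%MS <-> exists a b, p = a *: u + b *: v.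
Proof.
rewrite -addsmxE; split=> [/sub_addsmxP[[x y] ->]|[a [b ->]]].
  exists (x 0 0), (y 0 0).
  by rewrite [x in LHS]mx11_scalar [y in LHS]mx11_scalar !mul_scalar_mx.
by rewrite addmx_sub_adds// scalemx_sub.
Qed.

Lemma row_free_col_mx_neq0 u v : row_free (col_mx u v) -> u != 0.
Proof.
apply: contraTneq => ->.
by rewrite /row_free -addsmxE adds0mx neq_ltn ltnS rank_leq_row.
Qed.

(** Pairing a vanishing linear combination with each of the two vectors isolates one coefficient at
    a time. *)
Lemma row_free_orthogonal u v :
  u != 0 -> v != 0 -> dot u v = 0 -> row_free (col_mx u v).
Proof.
rewrite -!dot_gt0 => u0 v0 uv; apply: inj_row_free => x.
rewrite -[x]hsubmxK mul_row_col.
rewrite [lsubmx x]mx11_scalar [rsubmx x]mx11_scalar !mul_scalar_mx => xuv.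
have := congr1 (fun y => dot y u) xuv; have := congr1 (fun y => dot y v) xuv.
rewrite !dotDl !dotZl !dot0l (dotC v u) uv !mulr0 add0r addr0.
move=> /eqP; rewrite mulf_eq0 (gt_eqF v0) orbF => /eqP ->.
move=> /eqP; rewrite mulf_eq0 (gt_eqF u0) orbF => /eqP ->.
by rewrite !raddf0 row_mx0.
Qed.

Lemma developable_rm_field c N : immersed I c -> normal_field I c N ->
  (forall s, I s -> enorm (N s) = 1) ->
  developable I (ruled_surface c N) -> rm_field I c N.
Proof.
move=> [cs c0] [Ns Nc] N1 dev; split=> // s Is.
(* [w] is the normal part of [N'] at [s]. *)
set w := (X in X = _).
have hN := smooth_on_is_derive Ns Is.
have NN' := unit_field_derive_orthogonal N1 Is hN.
have N0 : N s != 0 by rewrite -enorm_gt0 N1.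
have [k N'E] : exists k, derive1 N s = k *: derive1 c s + w.
  exists (dot (derive1 N s) (derive1 c s) / dot (derive1 c s) (derive1 c s)).
  by rewrite addrC subrK.
have cc : dot (derive1 c s) (derive1 c s) != 0 by rewrite dot_eq0 c0.
have wc : dot w (derive1 c s) = 0.
  by rewrite /w dotDl dotNl dotZl divfK// subrr.
(* The formula for [w] is dropped: the decomposition [N'E] and orthogonality to [c'] suffice from
   here. *)
move: w N'E wc => w N'E wc.
have wN : dot w (N s) = 0.
  have := NN'; rewrite N'E dotDr dotZr Nc// mulr0 add0r dotC.
  exact.
(* A nonzero [w] makes the point at parameter 1 regular, as pairing [c' + N'] with [w] gives
   [dot w w]; the two planes may then be compared. *)
have [w0|w0] := eqVneq w 0; first exact: w0.
have reg0 : regular_point (ruled_surface c N) s 0.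
  rewrite /regular_point tangent_frame_ruled// scale0r addr0.
  by apply: row_free_orthogonal; rewrite ?c0// dotC Nc.
have reg1 : regular_point (ruled_surface c N) s 1.
  rewrite /regular_point tangent_frame_ruled// scale1r.
  apply: row_free_orthogonal => //; last first.
    by rewrite dotDl !(dotC _ (N s)) NN' Nc// addr0.
  apply: contra_neq w0 => /(congr1 (dot w)).
  rewrite N'E !dotDr dotZr wc mulr0 !add0r (dotC _ 0) dot0l => /eqP.
  by rewrite dot_eq0 => /eqP.
(* The test point is the end of the tangent vector [c' + N'] attached at parameter 1. It must lie in
   the plane at parameter 0, whose directions [c'] and [N] are orthogonal to [w]. *)
have : tangent_plane (ruled_surface c N) s 1
    (ruled_surface c N s 1 + (derive1 c s + derive1 N s)).
  rewrite /tangent_plane/= tangent_frame_ruled// scale1r addrC addKr.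
  by apply/sub_col_mxP; exists 1, 0; rewrite scale1r scale0r addr0.
rewrite -(dev s 0 1 Is reg0 reg1) /tangent_plane/= tangent_frame_ruled//.
rewrite /ruled_surface !scale0r !addr0 scale1r => /sub_col_mxP[a [b]].
move=> /(congr1 (dot w)).
rewrite N'E (addrC (c s)) -(addrA (N s)) (addrC (c s)) addrA addrK.
rewrite !dotDr !dotZr wc wN !mulr0 !add0r => /eqP.
by rewrite dot_eq0 => /eqP.
Qed.

(** The [s]-derivative is a multiple of [c'] all along the ruling, so the plane keeps the directions
    [c'] and [N]. The right-hand side is free of [lambda], which is what developability asks for. *)
Lemma tangent_plane_ruled c N s lambda k :
  smooth_on I c -> smooth_on I N -> I s -> derive1 N s = k *: derive1 c s ->
  regular_point (ruled_surface c N) s lambda ->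
  tangent_plane (ruled_surface c N) s lambda =
  [set p | (p - c s <= col_mx (derive1 c s) (N s))%MS].
Proof.
move=> cs Ns Is N'E.
rewrite /regular_point /tangent_plane tangent_frame_ruled// N'E scalerA.
rewrite -{1 3}[derive1 c s]scale1r -scalerDl.
(* If [q] were zero the frame would have a zero row, which regularity excludes. *)
set q := 1 + lambda * k => reg.
have q0 : q != 0.
  by move: (row_free_col_mx_neq0 reg); rewrite scaler_eq0 negb_or => /andP[].
(* Moving the base point from parameter [lambda] to [c s] shifts the coefficient of [N] by [lambda];
   [q] rescales that of [c']. *)
apply/seteqP; split=> p /= /sub_col_mxP[a [b pE]]; apply/sub_col_mxP.
  exists (a * q), (b + lambda).
  rewrite scalerDl addrA -scalerA -pE /ruled_surface opprD addrA.
  by rewrite subrK.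
exists (a / q), (b - lambda).
rewrite scalerA divfK// scalerBl addrA -pE /ruled_surface opprD addrA.
by [].
Qed.

Lemma rm_field_developable c N : immersed I c -> rm_field I c N ->
  developable I (ruled_surface c N).
Proof.
move=> [cs c0] [[Ns _] Nrm] s lambda mu Is regl regm.
have [k N'E] := (normal_derivative_eq0P _ (c0 s Is)).1 (Nrm s Is).
by rewrite !(tangent_plane_ruled cs Ns Is N'E).
Qed.

(** Write [b - a = l a']. Where [b = a], [l] vanishes and differentiation gives [b' - a' = l' a'];
    then [b'] is both parallel and orthogonal to [a'], hence zero, against immersion. *)
Lemma evolute_neq a b s : immersed I a -> immersed I b -> evolute I a b ->
  I s -> b s <> a s.
Proof.
move=> [as_ a0] [bs b0] [ab ortho] Is bas.
have aa t : I t -> dot (derive1 a t) (derive1 a t) != 0.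
  by rewrite dot_eq0; exact: a0.
(* The coordinate along the tangent line is given by a formula, since [range] yields it only
   pointwise, without differentiability. *)
pose l t := dot (b t - a t) (derive1 a t) / dot (derive1 a t) (derive1 a t).
have bE t : I t -> l t *: derive1 a t = b t - a t.
  move=> It; have [x _ /esym xE] := ab t It.
  rewrite /l xE /tangential_surface /ruled_surface [_ + x *: _]addrC addrK.
  by rewrite dotZl mulfK// aa.
have ndiff_a k := (smooth_ndiffP a).1 as_ k.
have ndiff_b k := (smooth_ndiffP b).1 bs k.
have na' : ndiff (I := I) 1 (derive1 a) := (ndiff_a 2%N).2.
have nw : ndiff (I := I) 1 (fun t => b t - a t).
  exact: ndiffB (ndiff_b 1%N) (ndiff_a 1%N).
have nl : ndiff (I := I) 1 l.
  exact: ndiffM (ndiff_dot openI nw na')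
    (ndiffV openI aa (ndiff_dot openI na' na')).
have dl := (ndiffS nl).1 s Is.
have da' : is_derive s 1 (derive1 a) (derive1 (derive1 a) s).
  exact/derivable_is_derive1/(as_ 1%N).
have ls0 : l s = 0 by rewrite /l bas subrr dot0l mul0r.
have h := is_derive1E (is_derive_scale dl da').
have hB := is_derive1E
  (is_deriveB (smooth_on_is_derive bs Is) (smooth_on_is_derive as_ Is)).
have b'E : derive1 b s = (1 + derive1 l s) *: derive1 a s.
  apply/eqP; rewrite scalerDl scale1r addrC -subr_eq -hB; apply/eqP.
  move: h; rewrite ls0 scale0r addr0 => <-.
  rewrite !derive1E; apply: near_eq_derive; apply: open_near_eq Is => // t It.
  by rewrite bE.
have := b0 s Is; rewrite -dot_eq0 {2}b'E dotZr ortho// mulr0 eqxx.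
by [].
Qed.

Lemma evolute_rm_field a b : immersed I a -> immersed I b -> evolute I a b ->
  rm_field I b (fun s => (enorm (b s - a s))^-1 *: (b s - a s)).
Proof.
move=> ia ib ev; have [as_ a0] := ia; have [bs b0] := ib; have [ab ortho] := ev.
pose r s := enorm (b s - a s).
have w0 s : I s -> b s - a s != 0.
  by move=> Is; rewrite subr_eq0; apply/eqP/(evolute_neq ia ib ev).
have r0 s : I s -> r s != 0 by move=> /w0; rewrite -enorm_gt0 => /gt_eqF->.
pose N s := (r s)^-1 *: (b s - a s).
have ndw k : ndiff (I := I) k (fun s => b s - a s).
  exact: ndiffB ((smooth_ndiffP b).1 bs k) ((smooth_ndiffP a).1 as_ k).
have ndr k : ndiff (I := I) k r.
  apply: (ndiff_sqrt openI _ (ndiff_dot openI (ndw k) (ndw k))) => s /w0.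
  by rewrite dot_gt0.
have Ns : smooth_on I N.
  apply/smooth_ndiffP => k.
  exact: (ndiff_scale openI (ndiffV openI r0 (ndr k)) (ndw k)).
(* As the curves never meet, the coordinate [x] of [b] on the tangent line is nonzero, and [a'] can
   be recovered from [N]. *)
have a'N s : I s -> exists k, derive1 a s = k *: N s.
  move=> Is; have [x _ /esym xE] := ab s Is.
  have wE : b s - a s = x *: derive1 a s.
    by rewrite xE /tangential_surface /ruled_surface addrC addKr.
  have x0 : x != 0 by apply: contraNneq (w0 s Is) => x0; rewrite wE x0 scale0r.
  exists (x^-1 * r s).
  by rewrite scalerA -mulrA divff ?r0// mulr1 wE scalerA mulVf// scale1r.
have Nb s : I s -> dot (N s) (derive1 b s) = 0.
  move=> Is; have [x _ /esym xE] := ab s Is.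
  rewrite /N xE /tangential_surface /ruled_surface [_ + x *: _]addrC addrK.
  by rewrite !dotZl dotC ortho// !mulr0.
have N1 s : I s -> enorm (N s) = 1.
  move=> Is; apply/eqP; rewrite -(@eqrXn2 _ 2)// ?sqrtr_ge0// expr1n sqr_enorm.
  by rewrite dotZl dotZr -sqr_enorm -/(r s) expr2 mulKf ?mulVf// r0.
have rN s : I s -> r s *: N s = b s - a s.
  by move=> Is; rewrite /N scalerA divff ?r0// scale1r.
rewrite -/N; clearbody N.
split=> [|s Is]; first by split.
apply/normal_derivative_eq0P; first exact: b0.
have dN := smooth_on_is_derive Ns Is.
have NN' := unit_field_derive_orthogonal N1 Is dN.
have dr := (ndiffS (ndr 1%N)).1 s Is.
have h := is_derive1E (is_derive_scale dr dN).
have hB := is_derive1E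
  (is_deriveB (smooth_on_is_derive bs Is) (smooth_on_is_derive as_ Is)).
have : derive1 (fun t => r t *: N t) s = derive1 (b - a) s.
  by rewrite !derive1E; apply: near_eq_derive; exact: open_near_eq rN Is.
rewrite h hB => /eqP; have [k ->] := a'N s Is.
rewrite eq_sym subr_eq addrAC -scalerDl; set q := _ + k => /eqP b'E.
(* Pairing [b' = q N + r N'] with the unit vector [N], orthogonal to [b'] and [N'], leaves only
   [q]. *)
have q0 : q = 0.
  have := Nb s Is; rewrite b'E dotDr !dotZr NN' mulr0 addr0 -sqr_enorm N1//.
  by rewrite expr1n mulr1.
exists (r s)^-1.
by rewrite b'E q0 scale0r add0r scalerA mulVf ?r0// scale1r.
Qed.

(** The derivative of [dot N N] is [2 a dot N c' = 0], so a single zero of [N] would spread over the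
    interval and force [N' = 0], whereas [a] and [c'] never vanish. *)
Lemma rm_field_neq0 c N (a : R -> R) : is_interval I -> immersed I c ->
  normal_field I c N ->
  (forall s, I s -> derive1 N s = a s *: derive1 c s) ->
  (forall s, I s -> a s != 0) -> forall s, I s -> N s != 0.
Proof.
move=> itvI [cs c0] [Ns Nc] N'E a0 s Is; apply/eqP => Ns0.
have cstN : forall t, I t -> dot (N t) (N t) = 0.
  have dNN x : I x -> is_derive x 1 (fun t => dot (N t) (N t)) 0.
    move=> Ix; have hN := smooth_on_is_derive Ns Ix.
    apply: (is_derive_eq (is_derive_dot hN hN)).
    by rewrite (dotC _ (N x)) N'E// dotZr Nc// mulr0 addr0.
  move=> t It; rewrite (derive0_cst itvI dNN It Is) Ns0.
  exact: dot0l.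
have N'0 : derive1 N s = 0.
  rewrite derive1E -(derive_cst (0 : 'rV[R]_3) s 1); apply: near_eq_derive.
  by apply: open_near_eq Is => // t /cstN/eqP; rewrite dot_eq0 => /eqP.
move/eqP: N'0; rewrite N'E// scaler_eq0 (negPf (a0 s Is)) (negPf (c0 s Is)).
by [].
Qed.

Lemma rm_field_tangential c N (a : R -> R) : is_interval I -> immersed I c ->
  normal_field I c N ->
  (forall s, I s -> derive1 N s = a s *: derive1 c s) ->
  (forall s, I s -> a s != 0) -> (forall s, I s -> derive1 a s != 0) ->
  is_tangential_surface I (ruled_surface c N).
Proof.
move=> itvI ic Nn N'E a0 a'0; have [cs c0] := ic; have [Ns _] := Nn.
have N0 := rm_field_neq0 itvI ic Nn N'E a0.
have ndc k := (smooth_ndiffP c).1 cs k.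
have ndN k := (smooth_ndiffP N).1 Ns k.
(* Smoothness of [a] comes from the quotient of [dot N' c'] by [dot c' c'], which equals [a] on
   [I]. *)
have nda k : ndiff (I := I) k a.
  have nc' : ndiff (I := I) k (derive1 c) := (ndc k.+1).2.
  have nN' : ndiff (I := I) k (derive1 N) := (ndN k.+1).2.
  have cc s : I s -> dot (derive1 c s) (derive1 c s) != 0.
    by rewrite dot_eq0; exact: c0.
  apply: (@ndiff_ext _ _ openI _ _ (fun s => dot (derive1 N s) (derive1 c s) *
    (dot (derive1 c s) (derive1 c s))^-1)) => [s Is|].
    by rewrite N'E// dotZl mulfK// cc.
  exact: (ndiffM openI (ndiff_dot openI nN' nc')
    (ndiffV openI cc (ndiff_dot openI nc' nc'))).
(* At parameter [- 1 / a] the factor [1 + lambda a] of [c'] in the [s]-derivative vanishes: [g] is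
   the edge of regression. *)
pose g s := c s - (a s)^-1 *: N s.
pose q s := derive1 a s / a s ^+ 2.
have q0 s : I s -> q s != 0.
  by move=> Is; rewrite mulf_neq0 ?a'0// invr_neq0// expf_neq0// a0.
have g'E s : I s -> derive1 g s = q s *: N s.
  move=> Is; have da := (ndiffS (nda 1%N)).1 s Is.
  have hc := smooth_on_is_derive cs Is; have hN := smooth_on_is_derive Ns Is.
  rewrite (is_derive1E (is_deriveB hc
    (is_derive_scale (is_derive_inv (a0 s Is) da) hN))).
  (* The term [N' / a] equals [c'] and cancels the derivative of [c], leaving a multiple of [N]. *)
  rewrite N'E// scalerA mulVf ?a0// scale1r opprD addrCA subrr addr0.
  by rewrite -scaleNr /q; congr (_ *: _); have := a0 s Is => ?; field.
exists g.
  split=> [|s Is]; last by rewrite g'E// scaler_eq0 negb_or q0//= N0.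
  apply/smooth_ndiffP => k.
  exact: (ndiffB openI (ndc k)
    (ndiff_scale openI (ndiffV openI a0 (nda k)) (ndN k))).
move=> s Is; rewrite /tangential_surface /ruled_surface g'E//.
(* Parameter [x] on the tangent line of [g] matches [x q - 1 / a] on the ruling; this change is
   invertible as [q] is nonzero. *)
apply/seteqP; split=> _ [x _ <-].
  exists ((x + (a s)^-1) / q s) => //.
  by rewrite scalerA divfK ?q0// scalerDl addrA addrAC /g subrK.
exists (x * q s - (a s)^-1) => //.
by rewrite scalerA scalerBl /g addrA addrAC.
Qed.

End Surfaces.

(** In the third clause, the conditions on [a] and its derivative exclude cylinders ([a] identically
    zero) and cones ([a] a nonzero constant, where the curve [alpha - N / a] shrinks to the vertex).
    In the second, [beta s <> alpha s] ensures that the normalization never divides by zero. *)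
Theorem proposition3 (R : realType) (I : set R) (alpha beta : R -> 'rV[R]_3)
    (hI : open_interval I)
    (halpha : immersed I alpha) (hbeta : immersed I beta) :
  (forall N : R -> 'rV[R]_3,
      normal_field I alpha N -> (forall s, I s -> enorm (N s) = 1) ->
      (developable I (ruled_surface alpha N) <-> rm_field I alpha N)) /\
  (evolute I alpha beta ->
      (forall s, I s -> beta s <> alpha s) /\
      rm_field I beta
        (fun s => (enorm (beta s - alpha s))^-1 *: (beta s - alpha s))) /\
  (forall (N : R -> 'rV[R]_3) (a : R -> R),
      rm_field I alpha N ->
      (forall s, I s -> derive1 N s = a s *: derive1 alpha s) ->
      (forall s, I s -> a s != 0) -> (forall s, I s -> derive1 a s != 0) ->
      is_tangential_surface I (ruled_surface alpha N)).
Proof.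
have [openI itvI] := hI; split=> [N Nn N1|].
  by split; [exact: developable_rm_field|exact: rm_field_developable].
split=> [ev|N a [Nn _] N'E a0 a'0].
  by split=> [s|]; [exact: evolute_neq|exact: evolute_rm_field].
exact: rm_field_tangential N'E a0 a'0.
Qed.
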